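(* Under the diffeomorphism $\psi\circ\mathcal F:\mathscr H\to\mathcal S$, for each $A=0,1,\dots,2n-1$ and $A'=0',1'$, $$(\psi\circ\mathcal F)_*Z_A^{A'}=\nabla_A^{A'}+\sum_{\alpha=0,1}C_A^{\alpha}\,\nabla_{2n+\alpha}^{A'}$$ (at the points of $\mathcal S$), where $(C_A^\alpha)$ is the $2n\times2$ matrix of functions obtained by stacking the $2\times2$ blocks $\tau(\overline\partial_{q_{l+1}}\phi)$, $l=0,\dots,n-1$, i.e. rows $2l$ and $2l+1$ of $(C_A^\alpha)$ are the two rows of $\tau(\overline\partial_{q_{l+1}}\phi)$.
   Context: The right quaternionic Heisenberg group is $\mathscr H=\mathbb H^n\times\operatorname{Im}\mathbb H\cong\mathbb R^{4n}\times\mathbb R^3$ with multiplication $(x,t)\cdot(y,s)=(x+y,\,t+s+2\operatorname{Im}(x\overline y))$, $x\overline y=\sum_l x_l\overline{y_l}$. In real coordinates $(y_1,\dots,y_{4n},s_1,s_2,s_3)$ it has left invariant vector fields $$Y_{4l+j}=\frac{\partial}{\partial y_{4l+j}}+2\sum_{\beta=1}^3\sum_{m=1}^4 B^\beta_{mj}\,y_{4l+m}\frac{\partial}{\partial s_\beta},\qquad l=0,\dots,n-1,\ j=1,\dots,4,$$ $$B^1=\begin{pmatrix}0&-1&0&0\\1&0&0&0\\0&0&0&-1\\0&0&1&0\end{pmatrix},\quad B^2=\begin{pmatrix}0&0&-1&0\\0&0&0&1\\1&0&0&0\\0&-1&0&0\end{pmatrix},\quad B^3=\begin{pmatrix}0&0&0&-1\\0&0&-1&0\\0&1&0&0\\1&0&0&0\end{pmatrix},$$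 and $Z_{2l}^{0'}=-Y_{4l+3}-\mathbf iY_{4l+4}$, $Z_{2l}^{1'}=-Y_{4l+1}-\mathbf iY_{4l+2}$, $Z_{2l+1}^{0'}=Y_{4l+1}-\mathbf iY_{4l+2}$, $Z_{2l+1}^{1'}=-Y_{4l+3}+\mathbf iY_{4l+4}$. On $\mathbb H^{n+1}$ use real coordinates $x_1,\dots,x_{4n+4}$ with $q_{l+1}=x_{4l+1}+\mathbf ix_{4l+2}+\mathbf jx_{4l+3}+\mathbf kx_{4l+4}$, $l=0,\dots,n$, and $q'=(q_1,\dots,q_n)$. Let $\nabla_{2l}^{0'}=-\partial_{x_{4l+3}}-\mathbf i\partial_{x_{4l+4}}$, $\nabla_{2l}^{1'}=-\partial_{x_{4l+1}}-\mathbf i\partial_{x_{4l+2}}$, $\nabla_{2l+1}^{0'}=\partial_{x_{4l+1}}-\mathbf i\partial_{x_{4l+2}}$, $\nabla_{2l+1}^{1'}=-\partial_{x_{4l+3}}+\mathbf i\partial_{x_{4l+4}}$, for $l=0,\dots,n$. Let $\overline\partial_{q_{l+1}}=\partial_{x_{4l+1}}+\mathbf i\partial_{x_{4l+2}}+\mathbf j\partial_{x_{4l+3}}+\mathbf k\partial_{x_{4l+4}}$. The embedding $\tau:\mathbb H\to\mathfrak{gl}(2,\mathbb C)$ is $$\tau(x_1+x_2\mathbf i+x_3\mathbf j+x_4\mathbf k)=\begin{pmatrix} x_1+\mathbf ix_2 & -x_3-\mathbf ix_4 \\ {} x_3-\mathbf ix_4 & x_1-\mathbf ix_2 \end{pmatrix}.$$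 The hypersurface is $\mathcal S=\{(q',q_{n+1})\in\mathbb H^{n}\times\mathbb H:\operatorname{Re}q_{n+1}=\phi(q')\}$ with $\phi(q')=\sum_{l=0}^{n-1}(-3x_{4l+1}^2+x_{4l+2}^2+x_{4l+3}^2+x_{4l+4}^2)$. The map $\psi:\mathbb H^n\times\operatorname{Im}\mathbb H\cong\mathbb R^{4n+3}\to\mathcal S$ is $\psi(q',\mathbf t)=(q',\phi(q')+\mathbf t)$, $\mathbf t=t_1\mathbf i+t_2\mathbf j+t_3\mathbf k$. The map $\mathcal F:\mathscr H\to\mathbb R^{4n+3}$, $(y,s)\mapsto(x,t)$, is $$x_{4l+j}=y_{4l+j},\qquad t_\beta=s_\beta+\sum_{l=0}^{n-1}\sum_{m,j=1}^4D^\beta_{mj}\,y_{4l+m}y_{4l+j},\qquad D^\beta=\tfrac12\left(C^\beta+(C^\beta)^t\right),$$ where $$C^1=\begin{pmatrix}0&-3&0&0\\-1&0&0&0\\0&0&0&-1\\0&0&1&0\end{pmatrix},\quad C^2=\begin{pmatrix}0&0&-3&0\\0&0&0&1\\-1&0&0&0\\0&-1&0&0\end{pmatrix},\quad C^3=\begin{pmatrix}0&0&0&-3\\0&0&-1&0\\0&1&0&0\\-1&0&0&0\end{pmatrix}$$ (the matrices $C^\beta$ are unrelated to the functions $C_A^\alpha$). Pushforward of complex vector fields is complex linear. *)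

(* Defs.v *)
From HB Require Import structures.
From mathcomp Require Import all_boot all_order all_algebra.
From mathcomp Require Import complex.
From mathcomp Require Import all_classical all_reals all_analysis.

Set Implicit Arguments.
Unset Strict Implicit.
Unset Printing Implicit Defensive.

Import Order.TTheory GRing.Theory Num.Theory.
Import numFieldNormedType.Exports.

Local Open Scope classical_set_scope.
Local Open Scope ring_scope.
Local Open Scope complex_scope.

(* Coordinates are numbered from 1: [crd x k] is x_k and [dd k] is the constant
   vector field d/dx_k. A vector field on R^N is the map sending a point to its
   vector of coefficients. *)
Definition crd (R : realType) (N : nat) (x : 'rV[R]_N) (k : nat) : R :=
  oapp (fun i : 'I_N => x 0 i) 0 (insub k.-1).

Definition dd (R : realType) (N : nat) (k : nat) : 'rV[R]_N :=
  \row_(i < N) ((i : nat) == k.-1)%:R.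

Definition entry (R : realType) (M : 'M[R]_4) (m j : nat) : R :=
  M (inord m.-1) (inord j.-1).

Definition mx4 (R : realType) (rows : seq (seq R)) : 'M[R]_4 :=
  \matrix_(i < 4, j < 4) (nth [::] rows i)`_j.

Record quaternion (R : Type) : Type :=
  Quat { q_re : R; q_i : R; q_j : R; q_k : R }.

Definition tau (R : realType) (q : quaternion R) : 'M[R[i]]_2 :=
  let: Quat x1 x2 x3 x4 := q in
  \matrix_(i < 2, j < 2)
    (nth [::] [:: [:: x1 +i* x2; (- x3) -i* x4];
                  [:: x3 -i* x4; x1 -i* x2]] i)`_j.

Section Smooth.
Variable R : realType.

(* For finite-dimensional V, continuity of x |-> 'd f x in operator norm is
   continuity of x |-> 'd f x v for every v. *)
Fixpoint is_Ck (k : nat) (V W : normedModType R) (f : V -> W) : Prop :=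
  if k is k'.+1 then
    (forall x : V, differentiable f x) /\
    (forall v : V, is_Ck k' (fun x : V => 'd f x v))
  else continuous f.

Definition smooth (V W : normedModType R) (f : V -> W) : Prop :=
  forall k : nat, is_Ck k f.

(* A map on a closed submanifold S is smooth iff it is the restriction of a
   smooth map on the ambient space. *)
Definition diffeomorphism_onto (V W : normedModType R) (f : V -> W)
    (S : set W) : Prop :=
  [/\ set_bij [set: V] S f, smooth f &
      exists2 g : W -> V, smooth g & cancel f g].

Definition diffC (m p : nat) (f : 'rV[R]_m -> 'rV[R]_p) (x : 'rV[R]_m)
    (v : 'rV[R[i]]_m) : 'rV[R[i]]_p :=
  map_mx (real_complex R) ('d f x (map_mx (@complex.Re R) v)) +
  'i%C *: map_mx (real_complex R) ('d f x (map_mx (@complex.Im R) v)).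

Definition push_field (m p : nat) (f : 'rV[R]_m -> 'rV[R]_p)
    (X : 'rV[R]_m -> 'rV[R[i]]_m) (x : 'rV[R]_p) : 'rV[R[i]]_p :=
  let y := pinv [set: 'rV[R]_m] f x in diffC f y (X y).

(* The complex fields indexed by A and A' are built from real fields
   X_{4l+j} = [X l j] in the same way for Z (from Y) and nabla (from d/dx). *)
Definition cfield (N : nat) (X : nat -> nat -> 'rV[R]_N) (A A' : nat) :
    'rV[R[i]]_N :=
  let l := A./2 in
  let XC j := map_mx (real_complex R) (X l j) in
  match odd A, A' with
  | false, 0%N => - XC 3%N - 'i%C *: XC 4%N
  | false, _   => - XC 1%N - 'i%C *: XC 2%N
  | true, 0%N  => XC 1%N - 'i%C *: XC 2%N
  | true, _    => - XC 3%N + 'i%C *: XC 4%N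
  end.

End Smooth.

Section Heisenberg.
Variables (R : realType) (n : nat).

Definition Bmx (beta : nat) : 'M[R]_4 :=
  match beta with
  | 1%N => mx4 [:: [:: 0; -1; 0; 0]; [:: 1; 0; 0; 0];
                   [:: 0; 0; 0; -1]; [:: 0; 0; 1; 0]]
  | 2%N => mx4 [:: [:: 0; 0; -1; 0]; [:: 0; 0; 0; 1];
                   [:: 1; 0; 0; 0]; [:: 0; -1; 0; 0]]
  | _   => mx4 [:: [:: 0; 0; 0; -1]; [:: 0; 0; -1; 0];
                   [:: 0; 1; 0; 0]; [:: 1; 0; 0; 0]]
  end.

Definition Cmx (beta : nat) : 'M[R]_4 :=
  match beta with
  | 1%N => mx4 [:: [:: 0; -3; 0; 0]; [:: -1; 0; 0; 0];
                   [:: 0; 0; 0; -1]; [:: 0; 0; 1; 0]]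
  | 2%N => mx4 [:: [:: 0; 0; -3; 0]; [:: 0; 0; 0; 1];
                   [:: -1; 0; 0; 0]; [:: 0; -1; 0; 0]]
  | _   => mx4 [:: [:: 0; 0; 0; -3]; [:: 0; 0; -1; 0];
                   [:: 0; 1; 0; 0]; [:: -1; 0; 0; 0]]
  end.

Definition Dmx (beta : nat) : 'M[R]_4 := 2^-1 *: (Cmx beta + (Cmx beta)^T).

(* A point (y, s) is [row_mx y s], so that s_beta has number 4n + beta. *)
Definition Yfield (p : 'rV[R]_(4 * n + 3)) (l j : nat) : 'rV[R]_(4 * n + 3) :=
  dd R _ (4 * l + j) +
  2 *: \sum_(1 <= beta < 4) \sum_(1 <= m < 5)
         (entry (Bmx beta) m j * crd p (4 * l + m)) *: dd R _ (4 * n + beta).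

Definition Zfield (A A' : nat) (p : 'rV[R]_(4 * n + 3)) : 'rV[R[i]]_(4 * n + 3) :=
  cfield (Yfield p) A A'.

Definition nabla (A A' : nat) : 'rV[R[i]]_(4 * n + 4) :=
  cfield (fun l j => dd R _ (4 * l + j)) A A'.

(* The quaternionic coordinate q_{l+1}. *)
Definition qcrd (N : nat) (x : 'rV[R]_N) (l : nat) : quaternion R :=
  Quat (crd x (4 * l + 1)) (crd x (4 * l + 2))
       (crd x (4 * l + 3)) (crd x (4 * l + 4)).

(* The operator dbar_{q_{l+1}}. *)
Definition dbar (N : nat) (l : nat) (f : 'rV[R]_N -> R) (x : 'rV[R]_N) :
    quaternion R :=
  Quat ('D_(dd R N (4 * l + 1)) f x) ('D_(dd R N (4 * l + 2)) f x)
       ('D_(dd R N (4 * l + 3)) f x) ('D_(dd R N (4 * l + 4)) f x).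

Definition phi (q' : 'rV[R]_(4 * n)) : R :=
  \sum_(0 <= l < n)
    (- 3 * crd q' (4 * l + 1) ^+ 2 + crd q' (4 * l + 2) ^+ 2 +
     crd q' (4 * l + 3) ^+ 2 + crd q' (4 * l + 4) ^+ 2).

Definition hypersurface : set 'rV[R]_(4 * n + 4) :=
  [set x | q_re (qcrd x n) = phi (lsubmx x)].

Definition psi (x : 'rV[R]_(4 * n + 3)) : 'rV[R]_(4 * n + 4) :=
  let q' := lsubmx x in
  let t := rsubmx x in
  row_mx q' (row_mx (phi q')%:M t : 'rV[R]_(1 + 3)).

Definition calF (p : 'rV[R]_(4 * n + 3)) : 'rV[R]_(4 * n + 3) :=
  let y := lsubmx p in
  let s := rsubmx p in
  row_mx y
    (\row_(b < 3)
       (s 0 b + \sum_(0 <= l < n) \sum_(1 <= m < 5) \sum_(1 <= j < 5)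
          entry (Dmx b.+1) m j * crd y (4 * l + m) * crd y (4 * l + j))).

(* Row A = 2l + (A mod 2) is a row of the l-th block. *)
Definition coefmx (x : 'rV[R]_(4 * n + 4)) : 'M[R[i]]_(2 * n, 2) :=
  \matrix_(A < 2 * n, alpha < 2)
    tau (dbar A./2 phi (lsubmx x)) (inord (odd A)) alpha.

End Heisenberg.

Arguments nabla R n A A' : clear implicits.
Arguments hypersurface R n : clear implicits.
Arguments psi R n x : clear implicits.
Arguments calF R n p : clear implicits.
Arguments Zfield R n A A' p : clear implicits.

(* Main.v *)
Require Import Defs.
From HB Require Import structures.
From mathcomp Require Import all_boot all_order all_algebra.
From mathcomp Require Import complex ring zify.
From mathcomp Require Import all_classical all_reals all_analysis.
Import GRing.Theory Num.Theory.
Import numFieldNormedType.Exports.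

Local Open Scope classical_set_scope.
Local Open Scope ring_scope.

(** Why the theorem holds.

    Write f for the composite of the two maps, l for a block of four
    coordinates and e_1, ..., e_4 for the quaternions 1, i, j, k.  In
    coordinates f sends (y, s) to (y, phi(y), s + Q(y)), where phi and the three
    components of Q are quadratic forms that are sums over the blocks of one
    4 x 4 form.  So f is polynomial, and it is undone by the polynomial map
    (x, h, t) |-> (x, t - Q(x)), which also inverts it on the graph h = phi(x);
    this is the diffeomorphism statement.

    For the vector fields, Y_{4l+j} moves y along the single coordinate 4l+j, so
    the derivative of f along it needs only the polarisation of these forms
    against a coordinate vector.  The t_beta component of the image is twice
    (B^beta + D^beta)_{mj} y_{4l+m} summed over m.  Since D^beta is the symmetric
    part of C^beta and B^beta is its antisymmetric part ([Bmx_Dmx_Cmx]), that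
    component is governed by C^beta alone: the change of variables Q exists to
    restore the symmetric part which the group law lacks.

    The matrices C^beta encode a quaternionic product: with g the value of
    dbar phi in block l, the last four components of the image of Y_{4l+j} are
    the coordinates of conj(g) e_j ([Cmx_conj_mul], [diff_embed_conj_mul]).
    Hence f maps Y_{4l+j} to the sum of the coordinate field 4l+j and of
    conj(g) e_j read as a vector in the q_{n+1} direction.

    When the fields with j = 1, ..., 4 are combined into complex ones, the
    operation e_j |-> conj(g) e_j becomes the action of the 2 x 2 complex matrix
    tau(g) on the pair of fields indexed by A = 2n and A = 2n+1
    ([tau_conj_mul]), for every quaternion g.  That is the asserted formula,
    because the complex fields are built from the real ones in the same way on
    both sides and the complexified differential commutes with that construction
    ([diffC_cfield]). *)

(** * Maps of class C^k *)

Section SmoothCalculus.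
Variable R : realType.
Local Set Implicit Arguments.
Local Unset Strict Implicit.

Lemma is_CkS k (V W : normedModType R) (f : V -> W) : is_Ck k.+1 f -> is_Ck k f.
Proof.
elim: k f => [|k IHk] f [df ddf].
  by move=> x; exact: differentiable_continuous.
by split=> // v; exact/IHk/ddf.
Qed.

Lemma is_Ck_cst k (V W : normedModType R) (a : W) : is_Ck k (fun _ : V => a).
Proof.
elim: k a => [|k IHk] a /=; first exact: cst_continuous.
split=> [x|v]; first exact: differentiable_cst.
under eq_fun do rewrite diff_cst.
exact: IHk.
Qed.

Lemma is_Ck_linear k (V W : normedModType R) (f : {linear V -> W}) :
  continuous f -> is_Ck k f.
Proof.
move=> cf; case: k => [//|k]; split=> [x|v].
  exact: linear_differentiable.
under eq_fun do rewrite diff_lin//.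
exact: is_Ck_cst.
Qed.

Lemma is_CkD k (V W : normedModType R) (f g : V -> W) :
  is_Ck k f -> is_Ck k g -> is_Ck k (fun x => f x + g x).
Proof.
elim: k f g => [|k IHk] f g.
  by move=> cf cg x; exact: (cvgD (cf x) (cg x)).
move=> [df ddf] [dg ddg]; split=> [x|v]; first exact: differentiableD.
under eq_fun do rewrite diffD//=.
exact: IHk (ddf v) (ddg v).
Qed.

(** The Leibniz rule expresses the derivative of a product through the factors
    themselves, so the induction on k also uses that the factors, of class
    C^(k+1), are of class C^k. *)
Lemma is_CkM k (V : normedModType R) (f g : V -> R) :
  is_Ck k f -> is_Ck k g -> is_Ck k (fun x => f x * g x).
Proof.
elim: k f g => [|k IHk] f g.
  by move=> cf cg x; exact: (cvgM (cf x) (cg x)).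
move=> Cf Cg; have [df ddf] := Cf; have [dg ddg] := Cg.
split=> [x|v]; first exact: differentiableM.
rewrite (_ : (fun x => _) = fun x => f x * 'd g x v + g x * 'd f x v); last first.
  by apply/funext => x; rewrite diffM.
by apply: is_CkD; apply: IHk; [exact: is_CkS|exact: ddg|exact: is_CkS|exact: ddf].
Qed.

Lemma is_CkZl k (V W : normedModType R) (f : V -> R) (w : W) :
  is_Ck k f -> is_Ck k (fun x => f x *: w).
Proof.
elim: k f => [|k IHk] f; first by move=> cf x; exact: (cvgZr_tmp (cf x)).
move=> [df ddf]; split=> [x|v]; first exact: differentiableZl.
under eq_fun do rewrite diffZl//.
exact: IHk (ddf v).
Qed.

Lemma is_Ck_sum k (V W : normedModType R) (I : Type) (r : seq I) (f : I -> V -> W) :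
  (forall i, is_Ck k (f i)) -> is_Ck k (fun x => \sum_(i <- r) f i x).
Proof.
move=> Cf; elim: r => [|i r IHr].
  by under eq_fun do rewrite big_nil; exact: is_Ck_cst.
under eq_fun do rewrite big_cons.
exact: is_CkD.
Qed.

(** A row vector is the sum of its coordinates times constant vectors: this
    reduces smoothness of a map to that of scalar functions. *)
Lemma is_Ck_rV k (V : normedModType R) N (f : V -> 'rV[R]_N) :
  (forall i, is_Ck k (fun x => f x 0 i)) -> is_Ck k f.
Proof.
move=> Cf; rewrite (_ : f = fun x => \sum_i f x 0 i *: delta_mx 0 i).
  by apply: is_Ck_sum => i; exact: is_CkZl.
by apply/funext => x; exact: row_sum_delta.
Qed.

Lemma is_Ck_coord k N (i : 'I_N) : is_Ck k (fun x : 'rV[R]_N => x 0 i : R).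
Proof.
have lin : linear (fun x : 'rV[R]_N => x 0 i : R) by move=> a x y; rewrite !mxE.
pose f := HB.pack_for {linear 'rV[R]_N -> R} (fun x : 'rV[R]_N => x 0 i : R)
  (GRing.isLinear.Build _ _ _ _ _ lin).
exact: (@is_Ck_linear k _ _ f (@coord_continuous _ _ _ _ _)).
Qed.

Lemma is_Ck_crd_lsubmx k N1 N2 (i : nat) :
  is_Ck k (fun x : 'rV[R]_(N1 + N2) => crd (lsubmx x) i).
Proof.
rewrite /crd; case: insub => [a|] /=; last exact: (@is_Ck_cst k _ _ 0).
by under eq_fun do rewrite mxE; exact: is_Ck_coord.
Qed.

End SmoothCalculus.

(** * Coordinates, constant fields and entries *)

Section Coordinates.
Variable R : realType.

Lemma crd_inord N (y : 'rV[R]_N) k (kN : (k.-1 < N)%N) : crd y k = y 0 (Ordinal kN).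
Proof. by rewrite /crd insubT. Qed.

Lemma crd_line N (h : R) (v y : 'rV[R]_N) k :
  crd (h *: v + y) k = h * crd v k + crd y k.
Proof.
by rewrite /crd; case: insub => [i|] /=; rewrite ?mxE// mulr0 addr0.
Qed.

Lemma crd_dd N j k : (0 < j)%N -> (0 < k <= N)%N -> crd (dd R N j) k = (j == k)%:R.
Proof.
case: j k => [|j] [|k]//= _ kN.
by rewrite crd_inord mxE eqSS eq_sym.
Qed.

Lemma crd_lsubmx N1 N2 (x : 'rV[R]_(N1 + N2)) k :
  (0 < k <= N1)%N -> crd (lsubmx x) k = crd x k.
Proof.
case: k => [|k]//= kN1; rewrite crd_inord.
have kN : (k < N1 + N2)%N by rewrite ltn_addr.
by rewrite crd_inord mxE; congr (x 0 _); exact: val_inj.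
Qed.

Lemma entry_mx4 (rows : seq (seq R)) m j : (0 < m <= 4)%N -> (0 < j <= 4)%N ->
  entry (mx4 rows) m j = (nth [::] rows m.-1)`_j.-1.
Proof.
by case: m j => [|m] [|j]//= m4 j4; rewrite /entry mxE !inordK.
Qed.

End Coordinates.

(** * Block quadratic forms *)

Section QuadraticMaps.
Variable R : realType.

Definition qform n (E : 'M[R]_4) (y : 'rV[R]_(4 * n)) : R :=
  \sum_(0 <= l < n) \sum_(1 <= m < 5) \sum_(1 <= j < 5)
     entry E m j * crd y (4 * l + m) * crd y (4 * l + j).

Lemma is_Ck_qform k (V : normedModType R) n (E : 'M[R]_4) (f : V -> 'rV[R]_(4 * n)) :
  (forall i, is_Ck k (fun x => crd (f x) i)) -> is_Ck k (fun x => qform n E (f x)).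
Proof.
move=> Cf; do 3![apply: is_Ck_sum => ?].
by do 2?apply: is_CkM; do ?exact: Cf; exact: is_Ck_cst.
Qed.

(** Only block l sees the direction of coordinate 4l + j, and the form of that
    block is polarised there: the linear term involves E plus its transpose, so
    the antisymmetric part of E does not contribute. *)
Lemma qform_line n E l j (y : 'rV[R]_(4 * n)) (h : R) :
    (l < n)%N -> (0 < j <= 4)%N ->
  qform n E (h *: dd R _ (4 * l + j) + y) = qform n E y +
    h * (\sum_(1 <= m < 5) (entry E m j + entry E j m) * crd y (4 * l + m)) +
    h ^+ 2 * entry E j j.
Proof.
move=> ln j4.
have crdE l' m : (l' < n)%N -> (0 < m <= 4)%N ->
    crd (h *: dd R (4 * n) (4 * l + j) + y) (4 * l' + m) =
    h * ((l == l') && (j == m))%:R + crd y (4 * l' + m).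
  move=> l'n m4; rewrite crd_line crd_dd; [|lia..].
  congr (h * (nat_of_bool _)%:R + _); lia.
apply/eqP; rewrite -addrA addrC -subr_eq; apply/eqP.
rewrite /qform -sumrB (bigD1_seq l) ?mem_index_iota ?iota_uniq//=.
rewrite [X in _ + X]big_nat_cond [X in _ + X]big1; last first.
  move=> l' /andP[/andP[_ l'n] l'l].
  apply/eqP; rewrite subr_eq0; apply/eqP.
  apply: eq_big_nat => m m4; apply: eq_big_nat => i i4.
  by rewrite !crdE// eq_sym (negPf l'l) mulr0 !add0r.
rewrite addr0 unlock /= !crdE// eqxx /=.
have : [|| j == 1, j == 2, j == 3 | j == 4]%N by lia.
by case/or4P => /eqP ->; rewrite /= ?mulr1n ?mulr0n; ring.
Qed.

(** When f is quadratic along the line through p in direction v, its difference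
    quotient is w + h u, so the derivative is read off as the coefficient of
    h. *)
Lemma derive_quadratic (V W : normedModType R) (f : V -> W) (p v : V) (w u : W) :
  (forall h : R, f (h *: v + p) = f p + h *: w + h ^+ 2 *: u) -> 'D_v f p = w.
Proof.
move=> fline; apply: cvg_lim => //.
have cvg_line : (fun h : R => w + h *: u) @ 0^' --> w.
  rewrite -[X in _ --> X]addr0 -[X in _ + X](scale0r u).
  apply: cvgD; first exact: cvg_cst.
  apply: cvgZr_tmp; exact: nbhs_dnbhs.
apply: cvg_trans cvg_line; apply: near_eq_cvg.
near=> h.
have h0 : h != 0 by near: h; exact: nbhs_dnbhs_neq.
rewrite /= fline -(addrA (f p)) (addrC (f p)) addrK scalerDr !scalerA mulVf// scale1r.
by rewrite expr2 mulKf.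
Unshelve. all: by end_near.
Qed.

End QuadraticMaps.

(** * The composite map as a diffeomorphism *)

Section Embedding.
Variables (R : realType) (n : nat).

Let embed := psi R n \o calF R n.

Definition phimx : 'M[R]_4 :=
  mx4 [:: [:: -3; 0; 0; 0]; [:: 0; 1; 0; 0]; [:: 0; 0; 1; 0]; [:: 0; 0; 0; 1]].

Lemma phiE (y : 'rV[R]_(4 * n)) : phi y = qform R n phimx y.
Proof.
apply: eq_bigr => l _; rewrite unlock /= !entry_mx4//=; ring.
Qed.

Lemma derive_phi l j (y : 'rV[R]_(4 * n)) : (l < n)%N -> (0 < j <= 4)%N ->
  'D_(dd R _ (4 * l + j)) (@phi R n) y =
  \sum_(1 <= m < 5) (entry phimx m j + entry phimx j m) * crd y (4 * l + m).
Proof.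
move=> ln j4; apply: (@derive_quadratic _ _ _ _ _ _ _ (entry phimx j j)) => h.
by rewrite !phiE qform_line.
Qed.

Lemma embedE (p : 'rV[R]_(4 * n + 3)) :
  embed p = row_mx (lsubmx p)
    (row_mx (phi (lsubmx p))%:M
       (\row_(b < 3) (rsubmx p 0 b + qform R n (Dmx R b.+1) (lsubmx p)))
       : 'rV[R]_(1 + 3)).
Proof. by rewrite /embed /= /psi /calF row_mxKl row_mxKr. Qed.

(** The coordinate Re q_{n+1} is dropped, since phi recovers it on the
    hypersurface; what remains is defined, and polynomial, on the whole
    ambient space. *)
Definition unembed (x : 'rV[R]_(4 * n + 4)) : 'rV[R]_(4 * n + 3) :=
  row_mx (lsubmx x)
    (\row_(b < 3) (rsubmx (rsubmx x : 'rV[R]_(1 + 3)) 0 b -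
                   qform R n (Dmx R b.+1) (lsubmx x))).

Lemma embedK : cancel embed unembed.
Proof.
move=> p; rewrite embedE /unembed !row_mxKl (row_mxKr (lsubmx p)) row_mxKr.
rewrite -[RHS]hsubmxK; congr row_mx.
by apply/rowP => b; rewrite !mxE addrK.
Qed.

Lemma crd_height (x : 'rV[R]_(4 * n + 4)) :
  crd x (4 * n + 1) = lsubmx (rsubmx x : 'rV[R]_(1 + 3)) 0 0.
Proof.
rewrite crd_inord; first by lia.
move=> kN; rewrite !mxE; congr (x 0 _); apply: val_inj => /=; lia.
Qed.

Lemma hypersurfaceE (x : 'rV[R]_(4 * n + 4)) :
  hypersurface R n x <-> lsubmx (rsubmx x : 'rV[R]_(1 + 3)) 0 0 = phi (lsubmx x).
Proof. by rewrite /hypersurface /= crd_height. Qed.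

Lemma embed_hypersurface p : hypersurface R n (embed p).
Proof.
by apply/hypersurfaceE; rewrite embedE row_mxKl row_mxKr row_mxKl mxE mulr1n.
Qed.

Lemma unembedK x : hypersurface R n x -> embed (unembed x) = x.
Proof.
move/hypersurfaceE => Sx; rewrite embedE /unembed row_mxKl row_mxKr -Sx.
rewrite -[RHS]hsubmxK -[rsubmx x in RHS](@hsubmxK _ _ 1 3).
apply: (congr2 row_mx erefl); apply: congr2; apply/rowP => b; rewrite !mxE.
  by rewrite ord1 eqxx mulr1n.
by rewrite subrK.
Qed.

Lemma smooth_embed : smooth embed.
Proof.
move=> k; rewrite (funext embedE).
apply: is_Ck_rV => i; case: (@split_ordP (4 * n) (1 + 3) i) => [a|c] ->.
  by under eq_fun do rewrite row_mxEl mxE; exact: is_Ck_coord.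
under eq_fun do rewrite row_mxEr.
case: (@split_ordP 1 3 c) => [c0|b] ->.
  rewrite (_ : (fun p => _) = fun p => qform R n phimx (lsubmx p)); last first.
    by apply/funext => p; rewrite (@row_mxEl _ 1 1 3) mxE ord1 eqxx mulr1n phiE.
  by apply: is_Ck_qform => ?; exact: is_Ck_crd_lsubmx.
rewrite (_ : (fun p => _) = fun p : 'rV[R]_(4 * n + 3) => p 0 (rshift (4 * n) b) +
    qform R n (Dmx R b.+1) (lsubmx p)); last first.
  by apply/funext => p; rewrite (@row_mxEr _ 1 1 3) !mxE.
by apply: is_CkD; [exact: is_Ck_coord|apply: is_Ck_qform => ?; exact: is_Ck_crd_lsubmx].
Qed.

Lemma smooth_unembed : smooth unembed.
Proof.
move=> k.
apply: is_Ck_rV => i; case: (split_ordP i) => [a|b] ->.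
  by under eq_fun do rewrite row_mxEl mxE; exact: is_Ck_coord.
rewrite (_ : (fun x => _) = fun x : 'rV[R]_(4 * n + 4) =>
    x 0 (rshift (4 * n) (rshift 1 b : 'I_(1 + 3))) +
    -1 * qform R n (Dmx R b.+1) (lsubmx x)); last first.
  by apply/funext => x; rewrite row_mxEr !mxE mulN1r.
apply: is_CkD; first exact: is_Ck_coord.
by apply: is_CkM; [exact: is_Ck_cst|apply: is_Ck_qform => ?; exact: is_Ck_crd_lsubmx].
Qed.

Lemma embed_diffeomorphism : diffeomorphism_onto embed (hypersurface R n).
Proof.
split; [split| |].
- by move=> p _; exact: embed_hypersurface.
- by move=> p q _ _ /(congr1 unembed); rewrite !embedK.
- by move=> x Sx; exists (unembed x) => //; exact: unembedK.
- exact: smooth_embed.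
- by exists unembed; [exact: smooth_unembed|exact: embedK].
Qed.

End Embedding.

(** * The differential on the left invariant fields *)

Section Pushforward.
Variables (R : realType) (n : nat).

Let embed := psi R n \o calF R n.

Local Arguments Bmx : simpl never.
Local Arguments Cmx : simpl never.

(** B^beta is the antisymmetric part of C^beta, and D^beta its symmetric part.
    This is where the group law, which provides B, and the quadratic change of
    variables, which provides D, are seen to fit together. *)
Lemma Bmx_Dmx_Cmx b m j : (0 < m <= 4)%N -> (0 < j <= 4)%N ->
  2 * entry (Bmx R b) m j + (entry (Dmx R b) m j + entry (Dmx R b) j m) =
  2 * entry (Cmx R b) m j.
Proof.
move=> m4 j4.
have -> : entry (Dmx R b) m j + entry (Dmx R b) j m =
          entry (Cmx R b) m j + entry (Cmx R b) j m.
  by rewrite /entry /Dmx !mxE; field.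
have : [|| m == 1, m == 2, m == 3 | m == 4]%N by lia.
have : [|| j == 1, j == 2, j == 3 | j == 4]%N by lia.
by case/or4P=> /eqP -> /or4P[] /eqP ->; case: b => [|[|[|b]]];
  rewrite /Bmx /Cmx /= !entry_mx4//=; ring.
Qed.

Lemma lsubmx_Yfield (p : 'rV[R]_(4 * n + 3)) l j :
  (l < n)%N -> (0 < j <= 4)%N -> lsubmx (Yfield p l j) = dd R _ (4 * l + j).
Proof.
move=> ln j4; apply/rowP => i; rewrite !mxE summxE big_nat_cond big1 ?mulr0 ?addr0//.
move=> b /andP[/andP[b0 _] _]; rewrite summxE big1// => m _; rewrite !mxE.
suff -> : ((lshift 3 i : nat) == (4 * n + b).-1) = false by rewrite mulr0.
by apply/eqP => /=; have := ltn_ord i; lia.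
Qed.

Lemma rsubmx_Yfield (p : 'rV[R]_(4 * n + 3)) l j (b : 'I_3) :
  (l < n)%N -> (0 < j <= 4)%N ->
  rsubmx (Yfield p l j) 0 b =
  2 * \sum_(1 <= m < 5) entry (Bmx R b.+1) m j * crd p (4 * l + m).
Proof.
move=> ln j4; rewrite !mxE summxE.
have -> : ((rshift (4 * n) b : nat) == (4 * l + j).-1) = false.
  by apply/eqP => /=; lia.
rewrite add0r; congr (2 * _).
rewrite (bigD1_seq b.+1) ?mem_index_iota ?iota_uniq//=; last first.
  by have := ltn_ord b; lia.
rewrite summxE [X in _ + X]big_nat_cond [X in _ + X]big1; last first.
  move=> i /andP[i0 ib]; rewrite summxE big1// => m _; rewrite !mxE /=.
  suff -> : (4 * n + b == (4 * n + i).-1)%N = false by rewrite mulr0.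
  by apply/eqP; lia.
rewrite addr0; apply: eq_bigr => m _; rewrite !mxE.
by rewrite [(4 * n + b.+1)%N]addnS eqxx mulr1.
Qed.

(** The proof expands the map along the line y + h Y: the group law contributes
    B^beta through the central part of Y, the form D^beta contributes D^beta
    plus its transpose, and the two add up to 2 C^beta. *)
Lemma diff_embed_Yfield (p : 'rV[R]_(4 * n + 3)) l j :
  (l < n)%N -> (0 < j <= 4)%N ->
  'd embed p (Yfield p l j) =
  row_mx (dd R _ (4 * l + j))
    (row_mx ('D_(dd R _ (4 * l + j)) (@phi R n) (lsubmx p))%:M
      (\row_(b < 3)
         (2 * \sum_(1 <= m < 5) entry (Cmx R b.+1) m j * crd p (4 * l + m)))
     : 'rV[R]_(1 + 3)).
Proof.
move=> ln j4; rewrite -deriveE; last by have [] := @smooth_embed R n 1%N.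
(* The coefficient of h^2: the forms evaluated on the coordinate vector. *)
apply: (@derive_quadratic _ _ _ _ _ _ _ (row_mx 0
  (row_mx (entry (phimx R) j j)%:M (\row_(b < 3) entry (Dmx R b.+1) j j)
   : 'rV[R]_(1 + 3)))) => h.
have lE : lsubmx (h *: Yfield p l j + p) =
    h *: dd R (4 * n) (4 * l + j) + lsubmx p.
  by rewrite -(lsubmx_Yfield p)//; apply/rowP => i; rewrite !mxE.
have rE b : rsubmx (h *: Yfield p l j + p) 0 b =
    h * rsubmx (Yfield p l j) 0 b + rsubmx p 0 b by rewrite !mxE.
rewrite [embed _]embedE [embed p]embedE !scale_row_mx !add_row_mx lE scaler0 addr0.
congr row_mx; first by rewrite addrC.
apply/rowP => c; case: (@split_ordP 1 3 c) => [c0|b] ->.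
  rewrite !(@row_mxEl _ 1 1 3) !mxE ord1 eqxx !mulr1n derive_phi//.
  by rewrite !phiE qform_line.
rewrite !(@row_mxEr _ 1 1 3) [LHS]mxE rE rsubmx_Yfield// !mxE qform_line//.
have -> : 2 * (\sum_(1 <= m < 5) entry (Cmx R b.+1) m j * crd p (4 * l + m)) =
    2 * (\sum_(1 <= m < 5) entry (Bmx R b.+1) m j * crd p (4 * l + m)) +
    \sum_(1 <= m < 5) (entry (Dmx R b.+1) m j + entry (Dmx R b.+1) j m) *
       crd (lsubmx p) (4 * l + m).
  rewrite !mulr_sumr -big_split; apply: eq_big_nat => m m4 /=.
  rewrite crd_lsubmx; last by lia.
  by rewrite !mulrA -mulrDl Bmx_Dmx_Cmx.
ring.
Qed.

(** * Complex fields built from real ones *)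

(** One coordinate of [cfield]: identities between complex fields become
    identities of complex numbers, with only the parity of A left. *)
Definition scalar_cfield (c : nat -> R[i]) (oddA : bool) (A' : nat) : R[i] :=
  match oddA, A' with
  | false, 0%N => - c 3%N - 'i%C * c 4%N
  | false, _   => - c 1%N - 'i%C * c 2%N
  | true, 0%N  => c 1%N - 'i%C * c 2%N
  | true, _    => - c 3%N + 'i%C * c 4%N
  end.

Lemma scalar_cfieldD (c d : nat -> R) b A' :
  scalar_cfield (fun j => (c j + d j)%:C%C) b A' =
  scalar_cfield (fun j => (c j)%:C%C) b A' + scalar_cfield (fun j => (d j)%:C%C) b A'.
Proof.
by rewrite /scalar_cfield; case: b; case: A' => [|A']; rewrite !rmorphD /=; ring.
Qed.

Lemma eq_scalar_cfield (c d : nat -> R[i]) b A' :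
  (forall j, (0 < j <= 4)%N -> c j = d j) ->
  scalar_cfield c b A' = scalar_cfield d b A'.
Proof. by move=> cd; rewrite /scalar_cfield !cd. Qed.

Lemma cfieldE N (X : nat -> nat -> 'rV[R]_N) A A' i :
  cfield X A A' 0 i = scalar_cfield (fun j => (X A./2 j 0 i)%:C%C) (odd A) A'.
Proof.
by rewrite /cfield /scalar_cfield; case: (odd A); case: A' => [|A']; rewrite !mxE.
Qed.

(** The complexified differential is complex linear on vectors u + i v with u
    and v real, and every field of the family is displayed in this form. *)
Lemma diffC_cfield N M (f : 'rV[R]_N -> 'rV[R]_M) p
    (X : nat -> nat -> 'rV[R]_N) A A' :
  diffC f p (cfield X A A') = cfield (fun l j => 'd f p (X l j)) A A'.
Proof.
have diffCD (u v : 'rV[R]_N) :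
    diffC f p (map_mx (real_complex R) u + 'i%C *: map_mx (real_complex R) v) =
    map_mx (real_complex R) ('d f p u) + 'i%C *: map_mx (real_complex R) ('d f p v).
  rewrite /diffC; congr (map_mx _ ('d f p _) + _ *: map_mx _ ('d f p _)).
    by apply/matrixP => i j; rewrite !mxE /=; ring.
  by apply/matrixP => i j; rewrite !mxE /=; ring.
rewrite /cfield; case: (odd A); case: A' => [|A'];
  by rewrite -?scalerN -!map_mxN diffCD ?linearN.
Qed.

End Pushforward.

(** * Quaternionic form of the pushforward *)

Section QuaternionicForm.
Variables (R : realType) (n : nat).

Let embed := psi R n \o calF R n.

(** The real coordinates of conj(g) e_j, where e_1, ..., e_4 are 1, i, j, k. *)
Definition conj_mul (g : quaternion R) (j : nat) : seq R :=
  let: Quat g1 g2 g3 g4 := g in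
  match j with
  | 1%N => [:: g1; - g2; - g3; - g4]
  | 2%N => [:: g2; g1; - g4; g3]
  | 3%N => [:: g3; g4; g1; - g2]
  | _   => [:: g4; - g3; g2; g1]
  end.

(** The pairs of complex fields are chosen so that left multiplication of the
    e_j by conj(g) amounts to applying tau(g) to the pair of fields with
    even and odd index; [e] lists the values of four real fields. *)
Lemma tau_conj_mul (g : quaternion R) (e : nat -> R) (b : bool) A' :
  scalar_cfield R (fun j => (\sum_(k < 4) (conj_mul g j)`_k * e k.+1)%:C%C) b A' =
  tau g (inord b) 0 * scalar_cfield R (fun j => (e j)%:C%C) false A' +
  tau g (inord b) 1 * scalar_cfield R (fun j => (e j)%:C%C) true A'.
Proof.
case: g => g1 g2 g3 g4; rewrite /scalar_cfield /tau !mxE !big_ord_recr !big_ord0 /=.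
by case: b; case: A' => [|A']; rewrite inordK//=;
  apply/eqP; rewrite eq_complex /=; apply/andP; split; apply/eqP; ring.
Qed.

(** Each C^beta permutes, up to sign and the factor -3 on the first coordinate,
    the y_m into the partial derivatives of phi; the weights -3, 1, 1, 1 of phi
    are the ones for which the three matrices assemble into one quaternionic
    product. *)
Lemma Cmx_conj_mul (y : 'rV[R]_(4 * n)) l j (b : 'I_3) :
  (l < n)%N -> (0 < j <= 4)%N ->
  2 * (\sum_(1 <= m < 5) entry (Cmx R b.+1) m j * crd y (4 * l + m)) =
  (conj_mul (dbar l (@phi R n) y) j)`_b.+1.
Proof.
move=> ln j4; rewrite /dbar !derive_phi// /phimx /=.
have : [|| j == 1, j == 2, j == 3 | j == 4]%N by lia.
by case/or4P => /eqP ->; case: b => [[|[|[|//]]] b3];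
  rewrite /Cmx /= unlock /= !entry_mx4//=; ring.
Qed.

(** In the q_{n+1} direction the real component is the derivative of phi along
    coordinate 4l + j, that is, the inner product of g with e_j, which is the
    real part of conj(g) e_j; the imaginary components are the C^beta terms. *)
Lemma diff_embed_conj_mul (p : 'rV[R]_(4 * n + 3)) l j :
  (l < n)%N -> (0 < j <= 4)%N ->
  'd embed p (Yfield p l j) = dd R _ (4 * l + j) +
  \sum_(k < 4) (conj_mul (dbar l (@phi R n) (lsubmx p)) j)`_k *: dd R _ (4 * n + k.+1).
Proof.
move=> ln j4; rewrite diff_embed_Yfield//.
have ddE k (c : 'I_(1 + 3)) :
    dd R (4 * n + 4) (4 * n + k.+1) 0 (rshift (4 * n) c) = (c == k :> nat)%:R.
  by rewrite mxE; congr (nat_of_bool _)%:R; apply/eqP/eqP => /=; lia.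
apply/rowP => i; case: (@split_ordP (4 * n) (1 + 3) i) => [a|c] ->.
  rewrite row_mxEl [RHS]mxE summxE [dd _ (4 * n) _ _ _]mxE.
  rewrite [dd R (4 * n + 4) (4 * l + j) _ _]mxE big1 ?addr0// => k _.
  rewrite !mxE; suff -> : (lshift (1 + 3) a == (4 * n + k.+1).-1 :> nat) = false.
    by rewrite mulr0.
  by apply/eqP => /=; have := ltn_ord a; lia.
rewrite row_mxEr [RHS]mxE summxE [dd R (4 * n + 4) (4 * l + j) _ _]mxE.
have -> : (rshift (4 * n) c == (4 * l + j).-1 :> nat) = false by apply/eqP => /=; lia.
rewrite add0r (bigD1 c)//= big1 ?addr0 => [|k kc]; last first.
  by rewrite mxE ddE (_ : (c == k :> nat) = false) ?mulr0// eq_sym; exact/negbTE.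
rewrite [RHS]mxE ddE eqxx mulr1; case: (@split_ordP 1 3 c) => [c0|b] ->.
  rewrite (@row_mxEl _ 1 1 3) mxE ord1 mulr1n.
  have : [|| j == 1, j == 2, j == 3 | j == 4]%N by lia.
  by case/or4P => /eqP ->.
rewrite (@row_mxEr _ 1 1 3) mxE -Cmx_conj_mul//; congr (2 * _).
by apply: eq_big_nat => m m4; rewrite crd_lsubmx//; lia.
Qed.

Lemma lin_comb2E (K : pzRingType) N (u : 'rV[K]_N) (c : 'I_2 -> K)
    (v : 'I_2 -> 'rV[K]_N) i :
  (u + \sum_(alpha < 2) c alpha *: v alpha) 0 i =
  u 0 i + (c 0 * v 0 0 i + c 1 * v 1 0 i).
Proof.
rewrite mxE summxE big_ord_recr big_ord1 /= !mxE.
by congr (_ + (c _ * v _ _ _ + c _ * v _ _ _)); exact: val_inj.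
Qed.

Lemma push_Zfield (A : 'I_(2 * n)) (A' : nat) (y : 'rV[R]_(4 * n + 3)) :
  diffC embed y (Zfield R n A A' y) =
  nabla R n A A' +
  \sum_(alpha < 2) coefmx (embed y) A alpha *: nabla R n (2 * n + alpha) A'.
Proof.
have ln : (A./2 < n)%N by have := ltn_ord A; lia.
have nablaE (alpha : 'I_2) i : nabla R n (2 * n + alpha) A' 0 i =
    scalar_cfield R (fun j => (dd R (4 * n + 4) (4 * n + j) 0 i)%:C%C) (odd alpha) A'.
  rewrite cfieldE; congr scalar_cfield; last by lia.
  apply/funext => j; congr (dd R _ (4 * _ + j) 0 i)%:C%C.
  by have := ltn_ord alpha; lia.
have coefE alpha : coefmx (embed y) A alpha =
    tau (dbar A./2 (@phi R n) (lsubmx y)) (inord (odd A)) alpha.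
  by rewrite mxE [embed y]embedE row_mxKl.
rewrite /Zfield diffC_cfield; apply/rowP => i.
rewrite lin_comb2E !coefE !nablaE !cfieldE.
rewrite -(tau_conj_mul _ (fun j => dd R (4 * n + 4) (4 * n + j) 0 i)) -scalar_cfieldD.
apply: eq_scalar_cfield => j j4; rewrite diff_embed_conj_mul// mxE summxE.
by congr (_ + _)%:C%C; apply: eq_bigr => k _; rewrite mxE.
Qed.

End QuaternionicForm.

Theorem proposition5p2 (R : realType) (n : nat) :
  diffeomorphism_onto (psi R n \o calF R n) (hypersurface R n) /\
  forall (A : 'I_(2 * n)) (A' : 'I_2) (x : 'rV[R]_(4 * n + 4)),
    hypersurface R n x ->
    push_field (psi R n \o calF R n) (Zfield R n A A') x =
    nabla R n A A' +
    \sum_(alpha < 2) coefmx x A alpha *: nabla R n (2 * n + alpha) A'.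
Proof.
split=> [|A A' x Sx]; first exact: embed_diffeomorphism.
have imx : x \in (psi R n \o calF R n) @` setT.
  by apply/mem_set; exists (unembed R n x) => //; exact: unembedK.
by rewrite /push_field push_Zfield pinvK.
Qed.
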